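(* For integers $m \ge 0$ and $d \ge 1$ let $M^{(m)}_d := \lim_{n\to\infty} \mathbb{E}\left[\left(\frac{H_d(n)}{n}\right)^m\right]$, where $H_d(n)$ is the number of balls in the fullest urn of the $d$-urn Polya process (with attachment probability proportional to the number of balls) when the total number of balls is $n$. Then these limits exist, and for all integers $m \ge 1$ and $d \ge 2$ each of the following three identities holds: $$M^{(m)}_d = \sum_{k=0}^{m} \frac{d-1}{d^k}\, \frac{m!}{(m-k)!}\, \frac{(m+d-k-2)!}{(m+d-1)!}\, M^{(m-k)}_{d-1},$$ $$M^{(m)}_d = \frac{d-1}{m+d-1}\, M^{(m)}_{d-1} + \frac{m}{d(m+d-1)}\, M^{(m-1)}_d,$$ $$M^{(m)}_d = \frac{m}{m+d-1} \sum_{j=1}^{d} \frac{(d-1)!}{j!}\, \frac{(m+j-2)!}{(m+d-2)!}\, M^{(m-1)}_j.$$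
   Context: Polya urn process (exponent $\gamma = 1$, ''proportional preferential attachment''): there are $d \ge 1$ urns, each initially containing exactly one ball. Balls are added one at a time; given the current configuration, the next ball is placed in a given urn with probability proportional to the number of balls currently in that urn (i.e. probability equal to the number of balls in that urn divided by the total number of balls). For $n \ge d$, $H_d(n)$ denotes the (random) maximum, over the $d$ urns, of the number of balls in the urn after $n-d$ balls have been added, so that there are $n$ balls in total. *)

(* Defs.v *)
From HB Require Import structures.
From mathcomp Require Import all_boot all_order all_algebra.
From mathcomp Require Import all_classical all_reals all_analysis.

Set Implicit Arguments.
Unset Strict Implicit.
Unset Printing Implicit Defensive.

Import Order.TTheory GRing.Theory Num.Theory.
Import numFieldNormedType.Exports.

Local Open Scope classical_set_scope.
Local Open Scope ring_scope.

Definition config (d : nat) := {ffun 'I_d -> nat}.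

Definition add_ball (d : nat) (c : config d) (i : 'I_d) : config d :=
  [ffun j => (c j + (j == i))%N].

(* [X k] is the configuration after [k] balls have been added.  The conditional
   probability of the next placement given the whole history is stated in
   product form, so that histories of probability zero need no convention. *)
Record polya_urn_process (R : realType) (disp : measure_display)
    (T : measurableType disp) (P : probability T R) (d : nat)
    (X : nat -> T -> config d) : Prop := PolyaUrnProcess {
  polya_measurable : forall (k : nat) (c : config d),
    measurable (X k @^-1` [set c]);
  polya_init : forall w : T, X 0%N w = [ffun=> 1%N];
  polya_step : forall (k : nat) (w : T),
    exists i : 'I_d, X k.+1 w = add_ball (X k w) i;
  polya_transition : forall (k : nat) (c : nat -> config d) (i : 'I_d),
    let history := [set w | forall j : nat, (j <= k)%N -> X j w = c j] in
    P (history `&` [set w | X k.+1 w = add_ball (c k) i]) =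
    (P history * ((c k i)%:R / (\sum_(j < d) c k j)%N%:R)%:E)%E }.

(* [n] is the total number of balls; only [d <= n] is meaningful, since [n - d]
   is truncated. *)
Definition fullest_urn (T : Type) (d : nat) (X : nat -> T -> config d)
    (n : nat) (w : T) : nat :=
  \max_(i < d) X (n - d)%N w i.

(* Main.v *)
Require Import Defs.
From HB Require Import structures.
From mathcomp Require Import all_boot all_order all_algebra.
From mathcomp Require Import all_classical all_reals all_analysis.
From mathcomp Require Import ring lra.

(** The moments of the fullest urn converge, and the limits have the closed form

      M(m, d) = m! (d-1)! / (m+d-1)! * sum_(1 <= k <= d) (-1)^(k+1) C(d, k) / k^m,

    from which the three identities are algebra.

    Averages over the process are computed by the transition operator.  Writing
    (T F)(c) for the mean of F after one more draw from configuration c,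
    conditioning on the last draw, then on the one before, and so on, gives
    E[F(X_r)] = (T^r F)(1, ..., 1) (expectation_polya_mean).  From then on only
    the positive linear functional F |-> (T^r F)(1, ..., 1), called polya_mean,
    matters.

    The key fact (polya_mean_exceeds) is that the probability that every urn i
    holds more than t_i balls depends on the t_i only through their sum.  (The
    law is uniform on the compositions of n into d positive parts, but this
    consequence is easier to get directly: T maps the indicator of
    {c_i > t_i for all i} to a combination of such indicators, where the total
    weight given to each total threshold depends only on the sum of the t_i.)  In particular the minimum
    over k given urns exceeds h with the same probability as the first urn
    exceeds k h, so that this minimum has the law of the first urn divided by k
    and rounded up.  Inclusion-exclusion for the maximum in terms of minima then
    yields polya_mean_max:

      E[f(max_i c_i)] = sum_(1 <= k <= d) (-1)^(k+1) C(d, k) E[f(ceil(c_0 / k))].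

    It remains to know the moments of one urn.  The rising factorial
    c_0 (c_0 + 1) ... (c_0 + m - 1) is an eigenfunction of T, so its mean is
    exactly m! (d-1)! / (m+d-1)! * n (n + 1) ... (n + m - 1) for n balls in all.
    After division by n^m, neither the rounding nor the replacement of powers by
    rising factorials matters in the limit (cvg_polya_mean_up_div), and the
    closed form follows.

    Writing S(m, d) for the alternating sum, Pascal's rule and
    k C(d, k) = d C(d-1, k-1) give S(m, d) = S(m, d-1) + S(m-1, d) / d.  This is
    the second identity up to the factorial prefactor; the first identity
    unrolls it in m and the third unrolls it in d. *)

Set Implicit Arguments.
Unset Strict Implicit.
Unset Printing Implicit Defensive.

Import Order.TTheory GRing.Theory Num.Theory.
Import numFieldNormedType.Exports.

Local Open Scope classical_set_scope.
Local Open Scope ring_scope.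

(** * The transition operator and expectations *)

Definition next_mean (R : realType) (d : nat) (F : config d -> R)
    (c : config d) : R :=
  \sum_(i < d) (c i)%:R / (\sum_(j < d) c j)%N%:R * F (add_ball c i).

Definition polya_mean (R : realType) (d r : nat) (F : config d -> R) : R :=
  iter r (@next_mean R d) F [ffun=> 1%N].

Section Law.
Context (R : realType) (disp : measure_display) (T : measurableType disp)
  (P : probability T R) (d : nat) (X : nat -> T -> config d).
Hypothesis hX : polya_urn_process P X.

Let history (k : nat) (c : nat -> config d) : set T :=
  [set w | forall j : nat, (j <= k)%N -> X j w = c j].

(** There are only countably many configurations, so measurability of the
    events X k = c makes every function of X k measurable. *)
Lemma measurable_config_fun (A : set T) (F : config d -> R) k :
  measurable A -> measurable_fun A (F \o X k).
Proof.
move=> mA _ B mB; apply: measurableI => //.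
have -> : (F \o X k) @^-1` B =
    \bigcup_(c : config d) ((X k @^-1` [set c]) `&` [set _ | B (F c)]).
  by apply/seteqP; split=> [w Bw|w [c _ [/= <-]]]; [exists (X k w)|].
apply: countable_bigcupT_measurable => [|c]; first exact: countableP.
apply: measurableI; first exact: polya_measurable hX _ _.
have [H|H] := pselect (B (F c)).
- rewrite (_ : [set _ | _] = setT); first exact: measurableT.
  by apply/seteqP; split.
- rewrite (_ : [set _ | _] = set0); first exact: measurable0.
  by apply/seteqP; split.
Qed.

Lemma measurable_history k c : measurable (history k c).
Proof.
rewrite (_ : history k c = \bigcap_(j in `I_k.+1) (X j @^-1` [set c j])).
  by apply: bigcap_measurable => [|j _]; [exists 0%N|exact: polya_measurable hX _ _].
by apply/seteqP; split=> w H j /= jk; exact: H.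
Qed.

Let extend (k : nat) (c : nat -> config d) (i : 'I_d) (j : nat) : config d :=
  if (j <= k)%N then c j else add_ball (c k) i.

Lemma history_extend k c i : history k.+1 (extend k c i) =
  history k c `&` [set w | X k.+1 w = add_ball (c k) i].
Proof.
apply/seteqP; split=> [w H|w [H1 /= H2] j].
- split=> [j jk|/=].
    by rewrite H ?(leq_trans jk)// /extend jk.
  by rewrite H// /extend ltnn.
- by rewrite leq_eqVlt ltnS /extend => /predU1P[->|jk]; rewrite ?ltnn// jk H1.
Qed.

Lemma history_split k c : history k c =
  \big[setU/set0]_(i < d) history k.+1 (extend k c i).
Proof.
rewrite -bigcup_seq; apply/seteqP; split=> [w Hw|w [i _]].
- have [i Hi] := polya_step hX k w; exists i; first by rewrite /= mem_index_enum.
  by rewrite history_extend; split=> //=; rewrite Hi Hw.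
- by rewrite history_extend => -[].
Qed.

Lemma add_ball_inj (c : config d) : injective (add_ball c).
Proof.
move=> i j /ffunP/(_ i); rewrite !ffunE eqxx => /addnI.
by case: (eqVneq i j).
Qed.

(** Backward induction on the number of remaining draws: the event of a given
    history splits according to the next urn drawn, and on each piece the
    transition law supplies the factor that [next_mean] averages with. *)
Lemma integral_history (F : config d -> R) : (forall c, 0 <= F c) ->
  forall r k c, (\int[P]_(w in history k c) (F (X (k + r)%N w))%:E =
    P (history k c) * (iter r (@next_mean R d) F (c k))%:E)%E.
Proof.
move=> F0; elim=> [|r IHr] k c.
  rewrite (eq_integral (cst (F (c k))%:E)); last first.
    by move=> w /set_mem Hw /=; rewrite addn0 Hw.
  rewrite integral_cst; last exact: measurable_history.
  by rewrite muleC.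
rewrite [in LHS]history_split ge0_integral_bigsetU//=.
- rewrite {1}/next_mean -sumEFin fin_num_sume_distrr//; last first.
    by apply: fin_num_measure; exact: measurable_history.
  apply: eq_bigr => i _; rewrite addnS -addSn IHr history_extend.
  by rewrite (polya_transition hX) -muleA -EFinM /extend ltnn.
- by move=> i; exact: measurable_history.
- exact: index_enum_uniq.
- move=> i j _ _ [w []]; rewrite !history_extend => -[_ /= ->] [_ /=].
  exact: add_ball_inj.
- rewrite -history_split.
  apply/measurable_realfun.measurable_EFinP; apply: (measurable_config_fun F).
  exact: measurable_history.
- by move=> w _; rewrite lee_fin.
Qed.

(** The history of length zero is the whole space. *)
Lemma expectation_polya_mean (F : config d -> R) k : (forall c, 0 <= F c) ->
  ('E_P[fun w => F (X k w)] = (polya_mean k F)%:E)%E.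
Proof.
move=> F0; have := integral_history F0 k 0 (fun=> [ffun=> 1%N]).
rewrite (_ : history _ _ = setT) ?probability_setT ?mul1e ?add0n.
  by move=> <-; rewrite expectation.unlock.
apply/seteqP; split=> // w _ j; rewrite leqn0 => /eqP ->.
exact: polya_init hX w.
Qed.
End Law.

(** * The mean after r draws as a positive functional *)

Section Mean.
Context (R : realType) (d : nat).
Implicit Types (F G : config d -> R) (c : config d).
Local Notation mean := (@polya_mean R d).

(** Configurations outside this set have weight zero in [polya_mean r], so
    functions need to be compared on it only. *)
Definition reachable (r : nat) c : bool :=
  (\sum_(j < d) c j == r + d)%N && [forall i, 0 < c i]%N.

Lemma reachable0 : reachable 0 [ffun=> 1%N].
Proof.
apply/andP; split; last by apply/forallP => i; rewrite ffunE.
by under eq_bigr do rewrite ffunE; rewrite sum1_card card_ord.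
Qed.

Lemma sum_add_ball c i : (\sum_(j < d) add_ball c i j = (\sum_(j < d) c j).+1)%N.
Proof.
under eq_bigr do rewrite ffunE.
rewrite big_split /= -addn1; congr addn.
by rewrite (bigD1 i)//= eqxx big1// => j /negPf ->.
Qed.

Lemma reachable_add_ball r c i : reachable r c -> reachable r.+1 (add_ball c i).
Proof.
case/andP => /eqP s /forallP p; apply/andP; split.
  by rewrite sum_add_ball s.
by apply/forallP => j; rewrite ffunE addn_gt0 p.
Qed.

Lemma polya_meanS r F : mean r.+1 F = mean r (@next_mean R d F).
Proof. by rewrite /polya_mean iterSr. Qed.

Lemma polya_mean_le r F G : (forall c, reachable r c -> F c <= G c) ->
  mean r F <= mean r G.
Proof.
elim: r F G => [|r IHr] F G FG; first exact/FG/reachable0.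
rewrite !polya_meanS; apply: IHr => c rc.
apply: ler_sum => i _; apply: ler_wpM2l; first exact: divr_ge0.
exact/FG/reachable_add_ball.
Qed.

Lemma polya_mean_eq r F G : (forall c, reachable r c -> F c = G c) ->
  mean r F = mean r G.
Proof.
by move=> FG; apply/le_anti/andP; split; apply: polya_mean_le => c /FG ->.
Qed.

Lemma polya_mean_sum r (I : Type) (s : seq I) (Q : pred I)
    (F : I -> config d -> R) :
  mean r (fun c => \sum_(i <- s | Q i) F i c) =
  \sum_(i <- s | Q i) mean r (F i).
Proof.
elim: r F => [//|r IHr] F; rewrite polya_meanS.
under [RHS]eq_bigr do rewrite polya_meanS.
rewrite -IHr; apply: polya_mean_eq => c _.
rewrite /next_mean exchange_big /=; apply: eq_bigr => j _.
by rewrite mulr_sumr.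
Qed.

Lemma polya_meanZ r a F : mean r (fun c => a * F c) = a * mean r F.
Proof.
elim: r F => [//|r IHr] F; rewrite !polya_meanS -IHr.
apply: polya_mean_eq => c _.
by rewrite /next_mean mulr_sumr; apply: eq_bigr => j _; rewrite mulrCA.
Qed.

Lemma polya_meanD r F G : mean r (fun c => F c + G c) = mean r F + mean r G.
Proof.
elim: r F G => [//|r IHr] F G; rewrite !polya_meanS -IHr.
apply: polya_mean_eq => c _.
by rewrite /next_mean -big_split; apply: eq_bigr => j _; rewrite mulrDr.
Qed.

Lemma polya_mean_cst r a : (0 < d)%N -> mean r (fun=> a) = a.
Proof.
move=> d0; elim: r => [//|r IHr]; rewrite polya_meanS -[RHS]IHr.
apply: polya_mean_eq => c /andP[/eqP s _].
rewrite /next_mean -mulr_suml -mulr_suml -natr_sum divff ?mul1r//.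
by rewrite s pnatr_eq0 addn_eq0 negb_and -!lt0n d0 orbT.
Qed.

Lemma polya_mean_dist r F G e : (0 < d)%N ->
  (forall c, reachable r c -> `|F c - G c| <= e) -> `|mean r F - mean r G| <= e.
Proof.
move=> d0 FG.
have -> : mean r F - mean r G = mean r (fun c => F c - G c).
  rewrite polya_meanD; congr (_ + _); rewrite -[LHS]mulN1r -polya_meanZ.
  by apply: polya_mean_eq => c _; rewrite mulN1r.
rewrite ler_norml -{1}(polya_mean_cst r (- e) d0) -{2}(polya_mean_cst r e d0).
by apply/andP; split; apply: polya_mean_le => c /FG; rewrite ler_norml => /andP[].
Qed.

End Mean.

(** * Joint tails depend on the total threshold only *)

Section JointTails.
Context (R : realType) (d : nat).
Implicit Types c t : config d.
Local Notation mean := (@polya_mean R d).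

Definition exceeds t c : bool := [forall i, t i < c i]%N.

Definition remove_ball t (i : 'I_d) : config d := [ffun j => (t j - (j == i))%N].

Lemma sum_remove_ball t i : (0 < t i)%N ->
  (\sum_(j < d) remove_ball t i j = (\sum_(j < d) t j).-1)%N.
Proof.
move=> ti; rewrite [in RHS](bigD1 i)//= (bigD1 i)//= ffunE eqxx.
rewrite (eq_bigr t) => [|j /negPf ji]; last by rewrite ffunE ji subn0.
by case: (t i) ti => // k _; rewrite subn1 addSn.
Qed.

(** Adding a ball to urn i can only help when c_i = t_i, and it then has the same
    effect as lowering t_i by one.  The weight c_i may thus be replaced by t_i in
    the correction term, which also disposes of the case t_i = 0, where the
    threshold cannot be lowered. *)
Lemma exceeds_add_ball t c i :
  (c i)%:R * (exceeds t (add_ball c i))%:R =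
  (c i)%:R * (exceeds t c)%:R
  + (t i)%:R * ((exceeds (remove_ball t i) c)%:R - (exceeds t c)%:R) :> R.
Proof.
have [ti0|ti_gt0] := posnP (t i).
  rewrite ti0 mul0r addr0.
  have [->|ci0] := posnP (c i); first by rewrite !mul0r.
  congr (_ * (nat_of_bool _)%:R); apply: eq_forallb => j; rewrite ffunE.
  by case: eqVneq => [->|_]; rewrite ?addn0// ti0 addn1 ci0.
have -> : exceeds (remove_ball t i) c = exceeds t (add_ball c i).
  apply: eq_forallb => j; rewrite !ffunE.
  case: eqVneq => [->|_]; rewrite ?subn0 ?addn0//.
  by rewrite subn1 addn1 ltnS prednK.
case: (boolP (exceeds t c)) => [/forallP tc|ntc].
  suff -> : exceeds t (add_ball c i) by ring.
  by apply/forallP => j; rewrite ffunE ltn_addr.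
case: (boolP (exceeds t (add_ball c i))) => [/forallP tc|_]; last by ring.
suff -> : c i = t i by ring.
apply/eqP; rewrite eqn_leq; apply/andP; split; last first.
  by have := tc i; rewrite ffunE eqxx addn1 ltnS.
rewrite leqNgt; apply: contra ntc => lt_tc; apply/forallP => j.
by case: (eqVneq j i) => [->//|ji]; have := tc j; rewrite ffunE (negPf ji) addn0.
Qed.

(** In the sum of the previous identity over i, the first terms collect the
    weights c_i - t_i, whose total depends only on the sum of the t_i. *)
Lemma next_mean_exceeds r t c : (0 < d)%N -> reachable r c ->
  next_mean (fun c => (exceeds t c)%:R) c =
  (1 - (\sum_(i < d) t i)%N%:R / (r + d)%:R) * (exceeds t c)%:R
  + \sum_(i < d) (t i)%:R / (r + d)%:R * (exceeds (remove_ball t i) c)%:R :> R.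
Proof.
move=> d0 /andP[/eqP s _]; rewrite /next_mean s.
have n0 : (r + d)%:R != 0 :> R.
  by rewrite pnatr_eq0 addn_eq0 negb_and -!lt0n d0 orbT.
under eq_bigr do rewrite mulrAC exceeds_add_ball.
transitivity (\sum_(i < d) ((((c i)%:R - (t i)%:R) / (r + d)%:R) * (exceeds t c)%:R
   + (t i)%:R / (r + d)%:R * (exceeds (remove_ball t i) c)%:R) : R).
  by apply: eq_bigr => i _; move: (r + d)%N n0 => n n0; field.
rewrite big_split /=; congr (_ + _).
rewrite -mulr_suml -mulr_suml big_split /= sumrN -!natr_sum s.
by rewrite mulrBl divff.
Qed.

(** By induction on r: every term of [next_mean_exceeds] with t_i > 0 lowers
    the total threshold by exactly one, so its mean does not depend on i. *)
Lemma polya_mean_exceeds r : (0 < d)%N ->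
  exists g : nat -> R, forall t,
    mean r (fun c => (exceeds t c)%:R) = g (\sum_(i < d) t i)%N.
Proof.
move=> d0; elim: r => [|r [g IHg]].
  exists (fun s => (s == 0%N)%:R) => t; congr (nat_of_bool _)%:R.
  rewrite sum_nat_eq0; apply: eq_forallb => i.
  by rewrite ffunE ltnS leqn0.
exists (fun s => (1 - s%:R / (r + d)%:R) * g s + s%:R / (r + d)%:R * g s.-1) => t.
rewrite polya_meanS.
rewrite (polya_mean_eq (fun c => @next_mean_exceeds r t c d0)).
rewrite polya_meanD polya_meanZ IHg; congr (_ + _).
rewrite polya_mean_sum natr_sum mulr_suml mulr_suml; apply: eq_bigr => i _.
rewrite polya_meanZ IHg; have [->|ti] := posnP (t i); first by rewrite !mul0r.
by rewrite sum_remove_ball.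
Qed.

End JointTails.

(** * Inclusion-exclusion for the maximum *)

Section InclusionExclusion.
Context (R : realType).

Definition alt_bin (d k : nat) : R := (-1) ^+ k.+1 * 'C(d, k)%:R.

Lemma sum_nonempty_set (I : finType) (f : nat -> R) :
  \sum_(S : {set I} | S != finset.set0) f #|S| =
  \sum_(1 <= k < #|I|.+1) 'C(#|I|, k)%:R * f k.
Proof.
rewrite [RHS](_ : _ = \sum_(1 <= k < #|I|.+1) \sum_(S : {set I} | #|S| == k) f k).
  (* Partition by size; size 0 contributes nothing, as S is nonempty. *)
  rewrite (partition_big (fun S : {set I} => inord #|S| : 'I_#|I|.+1) predT)//=.
  rewrite (big_addn 0 _ 1) subn1 /= big_mkord big_ord_recl /= big_pred0 ?add0r.
    apply: eq_bigr => k _; rewrite addn1; apply: eq_big => [S|S].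
      rewrite -card_gt0 -val_eqE /= inordK ?ltnS ?max_card// /bump /= add1n.
      by case: #|S|.
    by case/andP => _ /eqP/(congr1 val); rewrite /= inordK ?ltnS ?max_card// => ->.
  move=> S /=; rewrite -card_gt0 -val_eqE /= inordK ?ltnS ?max_card//.
  by case: #|S|.
apply: eq_bigr => k _; rewrite sumr_const -card_draws cardsE mulr_natl.
by congr (_ *+ _); exact: eq_card.
Qed.

(** Expand the product over i of 1 - [b i], which is the indicator that no b i
    holds, over the subsets S of I. *)
Lemma exists_incl_excl (I : finType) (b : pred I) :
  [exists i, b i]%:R = \sum_(S : {set I} | S != finset.set0)
    (-1) ^+ #|S|.+1 * [forall i in S, b i]%:R :> R.
Proof.
have : \prod_(i : I) (- (b i)%:R + 1) = (~~ [exists i, b i])%:R :> R.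
  rewrite negb_exists; case: (boolP [forall i, _]) => [/forallP nb|].
    by apply: big1 => i _; rewrite (negPf (nb i)) oppr0 add0r.
  rewrite negb_forall => /existsP[i]; rewrite negbK => bi.
  by rewrite (bigD1 i)//= bi addNr mul0r.
rewrite bigA_distr (bigD1 finset.set0)//= big1 => [|i]; last by rewrite inE.
move=> e; have : [exists i, b i]%:R = 1 - (~~ [exists i, b i])%:R :> R.
  by case: [exists i, b i]; rewrite ?subr0 ?subrr.
rewrite -e opprD addNKr -sumrN => ->; apply: eq_bigr => S _.
rewrite exprS mulN1r mulNr; congr (- _).
rewrite -big_mkcond /= -signr_odd.
rewrite prodrN; congr (_ * _); first by rewrite signr_odd.
case: (boolP [forall i in S, b i]) => [/forall_inP bS|].
  by apply: big1 => i /bS ->.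
rewrite negb_forall => /existsP[i]; rewrite negb_imply => /andP[iS /negPf bi].
by rewrite (bigD1 i)//= bi mul0r.
Qed.

(** The case of inclusion-exclusion where every b i holds. *)
Lemma sum_alt_bin d : (0 < d)%N -> \sum_(1 <= k < d.+1) alt_bin d k = 1.
Proof.
case: d => // d _; have := exists_incl_excl (fun _ : 'I_d.+1 => true).
have -> : [exists i : 'I_d.+1, true] by apply/existsP; exists ord0.
move=> e; rewrite -[RHS]/(true%:R) e.
rewrite (eq_bigr (fun S : {set _} => (-1) ^+ #|S|.+1)); last first.
  by move=> S _; rewrite (_ : [forall i in S, true]) ?mulr1//; apply/forall_inP.
rewrite (sum_nonempty_set _ (fun k => (-1) ^+ k.+1)) card_ord.
by apply: eq_bigr => k _; rewrite mulrC.
Qed.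

(** Summation by parts: it reduces the mean of f(Z) to the tails of Z. *)
Lemma telescope_tail (f : nat -> R) N x : (x <= N)%N ->
  f x = f 0%N + \sum_(h < N) (f h.+1 - f h) * (h < x)%N%:R.
Proof.
move=> xN; rewrite -(big_mkord xpredT (fun h => (f h.+1 - f h) * (h < x)%N%:R)).
rewrite (big_cat_nat _ xN)//= [X in _ + (_ + X)]big1_seq ?addr0; last first.
  by move=> i; rewrite mem_index_iota => /andP[_ /andP[xi _]]; rewrite ltnNge xi mulr0.
rewrite (eq_big_nat _ _ (F2 := fun h => f h.+1 - f h)); last first.
  by move=> i /andP[_ ->]; rewrite mulr1.
by rewrite telescope_sumr// addrC subrK.
Qed.

End InclusionExclusion.

Definition up_div (x k : nat) : nat := ((x + k.-1) %/ k)%N.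

Lemma ltn_up_div h x k : (0 < k)%N -> (h < up_div x k)%N = (k * h < x)%N.
Proof.
move=> k0; rewrite /up_div leq_divRL// mulSn [(x + _)%N]addnC [(k * h)%N]mulnC.
by case: k k0 => // k _; rewrite addSn -addnS leq_add2l.
Qed.

Lemma up_div_bounds x k : (0 < k)%N -> (x <= k * up_div x k <= x + k)%N.
Proof.
move=> k0; apply/andP; split.
  by rewrite leqNgt -ltn_up_div// ltnn.
rewrite mulnC (leq_trans (leq_divM _ _))// leq_add2l leq_pred//.
Qed.

Section MaxMean.
Context (R : realType) (n : nat).
Local Notation d := n.+1.
Local Notation mean := (@polya_mean R d).

(** The minimum over a set S of urns exceeds h when the thresholds h on S and 0
    off S are all exceeded, since no urn is ever empty.  The first urn divided by
    #|S| and rounded up exceeds h when the threshold #|S| h on that urn is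
    exceeded.  The totals agree, so the probabilities agree, and
    inclusion-exclusion over S gives the law of the maximum. *)
Lemma polya_mean_gt_max r h :
  mean r (fun c => (h < \max_(i < d) c i)%N%:R) =
  \sum_(1 <= k < d.+1)
    alt_bin R d k * mean r (fun c => (h < up_div (c ord0) k)%N%:R).
Proof.
have [g gE] := @polya_mean_exceeds R d r isT.
have g_one k : (0 < k)%N ->
    mean r (fun c => (h < up_div (c ord0) k)%N%:R) = g (k * h)%N.
  move=> k0; pose t : config d := [ffun i => if i == ord0 then (k * h)%N else 0%N].
  transitivity (mean r (fun c => (exceeds t c)%:R)).
    apply: polya_mean_eq => c /andP[_ /forallP c0].
    rewrite ltn_up_div//; congr (nat_of_bool _)%:R; apply/idP/forallP => [lt i|].
      by rewrite ffunE; case: eqP => // ->.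
    by move/(_ ord0); rewrite ffunE.
  rewrite gE; congr g; rewrite (bigD1 ord0)//= ffunE eqxx big1 ?addn0// => i.
  by rewrite ffunE => /negPf ->.
have g_set (S : {set 'I_d}) :
    mean r (fun c => [forall i in S, (h < c i)%N]%:R) = g (#|S| * h)%N.
  pose t : config d := [ffun i => if i \in S then h else 0%N].
  transitivity (mean r (fun c => (exceeds t c)%:R)).
    apply: polya_mean_eq => c /andP[_ /forallP c0].
    congr (nat_of_bool _)%:R; apply/forall_inP/forallP => [lt i|lt i iS].
      by rewrite ffunE; case: ifP => // /lt.
    by have := lt i; rewrite ffunE iS.
  rewrite gE; congr g; rewrite -sum_nat_const [RHS]big_mkcond.
  by apply: eq_bigr => i _; rewrite ffunE.
transitivity (\sum_(S : {set 'I_d} | S != finset.set0)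
    (-1) ^+ #|S|.+1 * g (#|S| * h)%N).
  under [RHS]eq_bigr do rewrite -g_set -polya_meanZ.
  rewrite -polya_mean_sum; apply: polya_mean_eq => c _.
  rewrite -(exists_incl_excl R (fun i => h < c i)%N); congr (nat_of_bool _)%:R.
  apply/idP/existsP => [|[i hi]]; last exact: leq_trans hi (leq_bigmax i).
  move=> hm; apply/existsP; apply: contraLR hm.
  rewrite negb_exists -leqNgt => /forallP hm; apply/bigmax_leqP => i _.
  by rewrite leqNgt.
rewrite (sum_nonempty_set _ (fun k => (-1) ^+ k.+1 * g (k * h)%N)) card_ord.
apply: eq_big_nat => k /andP[k0 _]; rewrite g_one// /alt_bin.
by rewrite mulrA; congr (_ * _); rewrite mulrC.
Qed.

Lemma polya_mean_telescope r (f : nat -> R) N (Z : config d -> nat) :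
  (forall c, reachable r c -> Z c <= N)%N ->
  mean r (fun c => f (Z c)) =
  f 0%N + \sum_(h < N) (f h.+1 - f h) * mean r (fun c => (h < Z c)%N%:R).
Proof.
move=> ZN; under eq_bigr do rewrite -polya_meanZ.
rewrite -polya_mean_sum -{1}(@polya_mean_cst R d r (f 0%N))// -polya_meanD.
by apply: polya_mean_eq => c /ZN; exact: telescope_tail.
Qed.

Lemma reachable_le r (c : config d) i : reachable r c -> (c i <= r + d)%N.
Proof. by case/andP => /eqP <- _; rewrite (bigD1 i)//= leq_addr. Qed.

Lemma polya_mean_max r (f : nat -> R) :
  mean r (fun c => f (\max_(i < d) c i)%N) =
  \sum_(1 <= k < d.+1)
    alt_bin R d k * mean r (fun c => f (up_div (c ord0) k)).
Proof.
rewrite (@polya_mean_telescope r f (r + d)); last first.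
  by move=> c rc; apply/bigmax_leqP => i _; exact: reachable_le.
transitivity (\sum_(1 <= k < d.+1) alt_bin R d k * (f 0%N +
   \sum_(h < r + d) (f h.+1 - f h) *
     mean r (fun c => (h < up_div (c ord0) k)%N%:R))).
  under eq_bigr do rewrite polya_mean_gt_max mulr_sumr.
  rewrite exchange_big /=.
  under [RHS]eq_bigr do rewrite mulrDr.
  rewrite big_split /= -mulr_suml sum_alt_bin// mul1r; congr (_ + _).
  apply: eq_bigr => k _; rewrite mulr_sumr; apply: eq_bigr => h _.
  by rewrite mulrCA.
apply: eq_big_nat => k /andP[k0 _]; congr (_ * _).
rewrite (@polya_mean_telescope r f (r + d))// => c rc.
by rewrite leqNgt ltn_up_div// -leqNgt (leq_trans (reachable_le _ rc))// leq_pmull.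
Qed.

End MaxMean.

(** * Moments of one urn *)

Section Rising.
Context (R : realType).

Definition rising (x : R) (m : nat) : R := \prod_(i < m) (x + i%:R).

Lemma rising_shift x m : x * rising (x + 1) m = (x + m%:R) * rising x m.
Proof.
rewrite /rising [RHS]mulrC -(big_ord_recr m (fun i => x + i%:R)) big_ord_recl /= addr0.
congr (_ * _); apply: eq_bigr => i _.
by rewrite /= /bump add1n -addrA -natr1 [1 + _]addrC.
Qed.

(** The m-th moment of one coordinate of a uniform point of the simplex with
    n.+1 coordinates. *)
Definition beta_coef (m n : nat) : R := m`!%:R * n`!%:R / (m + n)`!%:R.

Lemma rising_fact m n : n`!%:R * rising n.+1%:R m = (m + n)`!%:R.
Proof.
elim: m => [|m IHm]; first by rewrite /rising big_ord0 mulr1.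
rewrite /rising big_ord_recr /= mulrA [_ * \prod_(i < m) _]IHm -natrD -natrM.
by rewrite [(n.+1 + m)%N]addnC addnS addSn factS mulnC.
Qed.

Lemma rising_1 m : rising 1 m = m`!%:R.
Proof. by have := rising_fact m 0; rewrite fact0 mul1r addn0. Qed.

(** With x balls in the first urn out of N, that urn is drawn with probability
    x / N, and then the rising factorial is multiplied by (x + m) / x; the
    expected factor 1 + m / N is independent of x. *)
Lemma next_mean_rising n r m (c : config n.+1) : reachable r c ->
  next_mean (fun c => rising (c ord0)%:R m) c =
  (r + n.+1 + m)%:R / (r + n.+1)%:R * rising (c ord0)%:R m :> R.
Proof.
move=> /andP[/eqP s _]; rewrite /next_mean s.
set N := (r + n.+1)%N; have N0 : N%:R != 0 :> R by rewrite pnatr_eq0 /N addnS.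
rewrite (bigD1 ord0)//= ffunE eqxx addn1 -natr1 mulrAC rising_shift.
rewrite (eq_bigr (fun i => (c i)%:R * (N%:R^-1 * rising (c ord0)%:R m))); last first.
  by move=> i /negPf i0; rewrite ffunE eq_sym i0 addn0 mulrA.
rewrite -mulr_suml.
have -> : \sum_(i < n.+1 | i != ord0) (c i)%:R = N%:R - (c ord0)%:R :> R.
  by rewrite /N -s [in RHS](bigD1 ord0)//= natrD natr_sum addrC addKr.
rewrite natrD; move: N N0 => N N0; field; exact: N0.
Qed.

Lemma polya_mean_rising n r m :
  polya_mean r (fun c : config n.+1 => rising (c ord0)%:R m) =
  beta_coef m n * rising (r + n.+1)%:R m.
Proof.
elim: r => [|r IHr].
  rewrite /polya_mean /= ffunE rising_1 /beta_coef add0n -(rising_fact m n).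
  have : (m + n)`!%:R != 0 :> R by rewrite pnatr_eq0 -lt0n fact_gt0.
  rewrite -rising_fact mulf_eq0 negb_or => /andP[f0 r0].
  move: n`!%:R (rising _ m) m`!%:R f0 r0 => a b e a0 b0; field.
  by rewrite a0 b0.
rewrite polya_meanS (polya_mean_eq (@next_mean_rising n r m)) polya_meanZ IHr.
have N0 : (r + n.+1)%:R != 0 :> R by rewrite pnatr_eq0 addnS.
rewrite mulrCA; congr (_ * _); rewrite addSn -natr1.
apply: (mulfI N0); rewrite rising_shift -natrD.
by rewrite mulrA mulrCA mulfV// mulr1.
Qed.

Lemma dist_prod m (x y : nat -> R) B e : 1 <= B ->
  (forall i, (i < m)%N -> [/\ `|x i| <= B, `|y i| <= B & `|x i - y i| <= e]) ->
  `|\prod_(i < m) x i - \prod_(i < m) y i| <= m%:R * B ^+ m * e.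
Proof.
move=> B1; elim: m => [|m IHm] H; first by rewrite !big_ord0 subrr normr0 !mul0r.
have B0 : 0 <= B by apply: le_trans B1.
have [xB yB xye] := H m (leqnn _).
have e0 : 0 <= e by apply: le_trans xye.
rewrite !big_ord_recr /=; set X := \prod_(i < m) x i; set Y := \prod_(i < m) y i.
have -> : X * x m - Y * y m = (X - Y) * x m + Y * (x m - y m) by ring.
have YB : `|Y| <= B ^+ m.
  rewrite normr_prod -[m in _ ^+ m]card_ord -prodr_const.
  by apply: ler_prod => i _; rewrite normr_ge0 /=; have [] := H i (ltnW (ltn_ord i)).
apply: le_trans (ler_normD _ _) _; rewrite !normrM.
have -> : m.+1%:R * B ^+ m.+1 * e = m%:R * B ^+ m * e * B + B ^+ m.+1 * e.
  by rewrite -natr1 exprS; ring.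
apply: lerD; first by apply: ler_pM => //; apply: IHm => i im; exact/H/ltnW.
apply: ler_pM => //; apply: le_trans YB _; exact: ler_weXn2l.
Qed.

Lemma cvg_natr_inv n : (r + n.+1)%:R^-1 @[r --> \oo] --> (0 : R).
Proof.
have := @cvg_harmonic R; rewrite -(cvg_shiftn n); apply: cvg_trans.
by apply: near_eq_cvg; near=> r; rewrite /= addnS.
Unshelve. all: by end_near. Qed.

Lemma cvg_rising n m :
  rising (r + n.+1)%:R m / (r + n.+1)%:R ^+ m @[r --> \oo] --> (1 : R).
Proof.
elim: m => [|m IHm].
  rewrite /rising; under eq_cvg do rewrite big_ord0 expr0 divr1.
  exact: cvg_cst.
rewrite (_ : (fun r : nat => _) = (fun r =>
  (rising (r + n.+1)%:R m / (r + n.+1)%:R ^+ m)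
  * (1 + m%:R * (r + n.+1)%:R^-1))); last first.
  apply/funext => r; rewrite /rising big_ord_recr /= exprSr invfM.
  have N0 : (r + n.+1)%:R != 0 :> R by rewrite pnatr_eq0 addnS.
  by rewrite mulrACA mulrDl mulfV.
have : (rising (r + n.+1)%:R m / (r + n.+1)%:R ^+ m)
    * (1 + m%:R * (r + n.+1)%:R^-1) @[r --> \oo] --> (1 * (1 + m%:R * 0) : R).
  apply: cvgM => //; apply: cvgD; first exact: cvg_cst.
  by apply: cvgM; [exact: cvg_cst|exact: cvg_natr_inv].
by rewrite mulr0 addr0 mulr1.
Qed.

(** Both m-th powers are, up to the common factor k^-m, products of m factors
    within (k + m) / N of the proportion of balls in the first urn. *)
Lemma up_div_rising_dist n r m k (c : config n.+1) : (0 < k)%N -> reachable r c ->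
  `|((up_div (c ord0) k)%:R / (r + n.+1)%:R) ^+ m -
    k%:R ^- m * (r + n.+1)%:R ^- m * rising (c ord0)%:R m|
  <= m%:R * (1 + k + m)%:R ^+ m * ((k + m)%:R / (r + n.+1)%:R) :> R.
Proof.
move=> k0 rc; set N := (r + n.+1)%N; set B : R := (1 + k + m)%:R.
have N0 : 0 < N%:R :> R by rewrite ltr0n /N addnS.
have kR0 : 0 < k%:R :> R by rewrite ltr0n.
have B1 : 1 <= B by rewrite ler1n.
have cN := reachable_le ord0 rc.
have /andP[lo hi] := up_div_bounds (c ord0) k0.
pose x (i : nat) : R := (k * up_div (c ord0) k)%:R / N%:R.
pose y (i : nat) : R := (c ord0 + i)%:R / N%:R.
have -> : ((up_div (c ord0) k)%:R / N%:R) ^+ m -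
    k%:R ^- m * N%:R ^- m * rising (c ord0)%:R m =
    k%:R ^- m * (\prod_(i < m) x i - \prod_(i < m) y i) :> R.
  rewrite mulrBr; congr (_ - _).
    rewrite prodr_const card_ord -exprVn -exprMn natrM; congr (_ ^+ _).
    by rewrite !mulrA mulVf ?mul1r// gt_eqF.
  rewrite -mulrA; congr (_ * _).
  rewrite /y big_split /= prodr_const card_ord exprVn mulrC.
  by congr (_ * _); apply: eq_bigr => i _; rewrite natrD.
rewrite normrM normrV ?unitfE ?expf_neq0 ?gt_eqF// ger0_norm ?exprn_ge0 ?ler0n//.
pose e : R := (k + m)%:R / N%:R.
apply: le_trans (dist_prod (x := x) (y := y) (B := B) (e := e) B1 _); last first.
  move=> i im; rewrite /x /y /e; split.
  - rewrite ger0_norm ?divr_ge0// ler_pdivrMr// -natrM ler_nat.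
    rewrite (leq_trans hi)// mulnDl mulnDl mul1n -addnA leq_add//.
    by apply: leq_trans (leq_addr _ _); rewrite leq_pmulr// /N addnS.
  - rewrite ger0_norm ?divr_ge0// ler_pdivrMr// -natrM ler_nat.
    rewrite mulnDl mulnDl mul1n -addnA leq_add//.
    apply: leq_trans (ltnW im) _; apply: leq_trans (leq_addl _ _).
    by rewrite leq_pmulr// /N addnS.
  - rewrite -mulrBl normrM [X in _ * X]ger0_norm ?invr_ge0//.
    rewrite ler_pM2r ?invr_gt0// ler_norml.
    have lo' : (c ord0)%:R <= (k * up_div (c ord0) k)%:R :> R by rewrite ler_nat.
    have hi' : (k * up_div (c ord0) k)%:R <= (c ord0)%:R + k%:R :> R.
      by rewrite -natrD ler_nat.
    have im' : i%:R <= m%:R :> R by rewrite ler_nat ltnW.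
    have i0 : 0 <= i%:R :> R by [].
    rewrite !natrD; move: (_%:R) lo' hi' => z lo' hi'.
    by apply/andP; split; lra.
rewrite ler_piMl// invf_le1 ?exprn_gt0// exprn_ege1// ler1n//.
Qed.

Lemma cvg_polya_mean_up_div n m k : (0 < k)%N ->
  polya_mean r (fun c : config n.+1 =>
      ((up_div (c ord0) k)%:R / (r + n.+1)%:R) ^+ m)
    @[r --> \oo] --> beta_coef m n / k%:R ^+ m.
Proof.
move=> k0; pose C : R := m%:R * (1 + k + m)%:R ^+ m * (k + m)%:R.
pose v (r : nat) : R := beta_coef m n / k%:R ^+ m *
  (rising (r + n.+1)%:R m / (r + n.+1)%:R ^+ m).
have cv : v @ \oo --> beta_coef m n / k%:R ^+ m.
  rewrite -[X in _ --> X]mulr1; apply: cvgM; [exact: cvg_cst|exact: cvg_rising].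
(* C / N is the error bound of up_div_rising_dist. *)
have cC : C * (r + n.+1)%:R^-1 @[r --> \oo] --> (0 : R).
  by rewrite -(mulr0 C); apply: cvgM; [exact: cvg_cst|exact: cvg_natr_inv].
have bnd r : `|polya_mean r (fun c : config n.+1 =>
    ((up_div (c ord0) k)%:R / (r + n.+1)%:R) ^+ m) - v r| <= C * (r + n.+1)%:R^-1.
  have -> : v r = polya_mean r (fun c : config n.+1 =>
      k%:R ^- m * (r + n.+1)%:R ^- m * rising (c ord0)%:R m).
    by rewrite polya_meanZ polya_mean_rising /v; ring.
  rewrite /C -mulrA; apply: polya_mean_dist => // c.
  exact: up_div_rising_dist.
apply: (@squeeze_cvgr _ _ _ _ (fun r => v r - C * (r + n.+1)%:R^-1)
  (fun r => v r + C * (r + n.+1)%:R^-1)).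
- by near=> r; have := bnd r; rewrite ler_distl.
- by rewrite -[X in _ --> X]subr0; apply: cvgB.
- by rewrite -[X in _ --> X]addr0; apply: cvgD.
Unshelve. all: by end_near. Qed.

End Rising.

(** * The limits and their recurrences *)

Section Identities.
Context (R : realType).

Definition alt_harmonic (m d : nat) : R :=
  \sum_(1 <= k < d.+1) alt_bin R d k / k%:R ^+ m.

Definition limit_moment (m d : nat) : R := beta_coef R m d.-1 * alt_harmonic m d.

(** Pascal's rule splits C(d+1, k) into C(d, k) and C(d, k-1), and the latter is
    k C(d+1, k) / (d+1), where the factor k lowers the exponent of 1/k. *)
Lemma alt_harmonicS m d : alt_harmonic m.+1 d.+1 =
  alt_harmonic m.+1 d + alt_harmonic m d.+1 / d.+1%:R.
Proof.
have -> : alt_harmonic m.+1 d = \sum_(1 <= k < d.+2) alt_bin R d k / k%:R ^+ m.+1.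
  by rewrite big_nat_recr//= /alt_bin bin_small// mulr0 mul0r addr0.
rewrite /alt_harmonic mulr_suml -big_split; apply: eq_big_nat => -[//|k] _ /=.
have k0 : k.+1%:R != 0 :> R by rewrite pnatr_eq0.
have d0 : d.+1%:R != 0 :> R by rewrite pnatr_eq0.
have kbin : k.+1%:R * 'C(d.+1, k.+1)%:R = d.+1%:R * 'C(d, k)%:R :> R.
  by rewrite -!natrM mul_bin_diag.
have -> : alt_bin R d.+1 k.+1 / k.+1%:R ^+ m / d.+1%:R =
    (-1) ^+ k.+2 * 'C(d, k)%:R / k.+1%:R ^+ m.+1.
  rewrite /alt_bin [k.+1%:R ^+ _.+1]exprSr invfM.
  have -> : 'C(d.+1, k.+1)%:R = d.+1%:R * 'C(d, k)%:R / k.+1%:R :> R.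
    by rewrite -kbin mulrAC mulfV// mul1r.
  have km0 : k.+1%:R ^+ m != 0 :> R by rewrite expf_neq0.
  move: d.+1%:R k.+1%:R (k.+1%:R ^+ m) km0 k0 d0 => e b a a0 b0 e0; field.
  by rewrite a0 b0 e0.
by rewrite -mulrDl /alt_bin binS natrD mulrDr.
Qed.

Lemma limit_moment0 d : (0 < d)%N -> limit_moment 0 d = 1.
Proof.
move=> d0; rewrite /limit_moment /alt_harmonic /beta_coef add0n mul1r.
rewrite divff ?mul1r; last by rewrite pnatr_eq0 -lt0n fact_gt0.
rewrite -[RHS](sum_alt_bin R d0); apply: eq_bigr => k _.
by rewrite expr0 divr1.
Qed.

Lemma limit_moment1 m : limit_moment m 1 = 1.
Proof.
rewrite /limit_moment /alt_harmonic big_nat1 /alt_bin /beta_coef /= addn0.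
rewrite expr1n sqrrN expr1n bin1 fact0 !mulr1 divff ?mul1r ?invr1//.
Qed.

Lemma limit_moment_rec m d : limit_moment m.+1 d.+2 =
  d.+1%:R / (m + d).+2%:R * limit_moment m.+1 d.+1
  + m.+1%:R / (d.+2%:R * (m + d).+2%:R) * limit_moment m d.+2.
Proof.
rewrite /limit_moment alt_harmonicS /beta_coef /= !addnS !addSn !factS !natrM.
have f0 : (m + d)`!%:R != 0 :> R by rewrite pnatr_eq0 -lt0n fact_gt0.
have d0 : d.+2%:R != 0 :> R by rewrite pnatr_eq0.
have m1 : (m + d).+1%:R != 0 :> R by rewrite pnatr_eq0.
have m2 : (m + d).+2%:R != 0 :> R by rewrite pnatr_eq0.
move: ((m + d)`!%:R) (d.+2%:R) ((m + d).+1%:R) ((m + d).+2%:R) f0 d0 m1 m2.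
move: m.+1%:R m`!%:R d.+1%:R d`!%:R (alt_harmonic _ _) (alt_harmonic _ _).
move=> a b e f S1 S2 g h i j g0 h0 i0 j0; field.
by rewrite g0 h0 i0 j0.
Qed.

Lemma fact_neq0 k : k`!%:R != 0 :> R.
Proof. by rewrite pnatr_eq0 -lt0n fact_gt0. Qed.

Lemma natr_factS k : k.+1`!%:R = k.+1%:R * k`!%:R :> R.
Proof. by rewrite factS natrM. Qed.

(** The recurrence [limit_moment_rec] iterated downwards in m: its first term is
    the summand k = 0 and its second one shifts the remaining summands. *)
Lemma limit_moment_sum_order m d :
  limit_moment m d.+2 = \sum_(0 <= k < m.+1)
     d.+1%:R / d.+2%:R ^+ k * (m`!%:R / (m - k)%N`!%:R)
     * ((m + d - k)%N`!%:R / (m + d).+1`!%:R) * limit_moment (m - k) d.+1.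
Proof.
elim: m => [|m IHm].
  rewrite big_nat1 !limit_moment0// expr0 subnn fact0 !divr1 subn0 !mulr1.
  have d0 : d.+1%:R != 0 :> R by rewrite pnatr_eq0.
  rewrite add0n factS natrM; move: (fact_neq0 d) d0.
  by move: d`!%:R d.+1%:R => a b a0 b0; field; rewrite a0 b0.
rewrite limit_moment_rec big_nat_recl//= addSn; congr (_ + _).
  rewrite expr0 !subn0 divr1 divff ?fact_neq0// mulr1 [(m + d).+2`!]factS natrM invfM.
  by rewrite [(_ + _).+1`!%:R * _]mulrCA divff ?fact_neq0// mulr1.
rewrite IHm big_distrr; apply: eq_big_nat => k _ /=.
rewrite !subSS (natr_factS (m + d).+1) (natr_factS m) exprS.
have d0 : d.+2%:R != 0 :> R by rewrite pnatr_eq0.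
have dk : d.+2%:R ^+ k != 0 :> R by rewrite expf_neq0.
have m2 : (m + d).+2%:R != 0 :> R by rewrite pnatr_eq0.
move: (fact_neq0 (m - k)) (fact_neq0 (m + d).+1) d0 dk m2.
move: ((m - k)`!%:R) ((m + d).+1`!%:R) (d.+2%:R) (d.+2%:R ^+ k) ((m + d).+2%:R).
move: m.+1%:R d.+1%:R (_`!%:R) m`!%:R (limit_moment _ _).
move=> a b e f S g h i j l g0 h0 j0 i0 l0; field.
by rewrite g0 h0 i0 j0 l0.
Qed.

(** The recurrence [limit_moment_rec] iterated downwards in d: its second term is
    the summand of largest index and its first one rescales all the others. *)
Lemma limit_moment_sum_urns m d :
  limit_moment m.+1 d.+1 = m.+1%:R / (m + d).+1%:R *
   \sum_(1 <= j < d.+2) d`!%:R / j`!%:R * ((m + j.-1)`!%:R / (m + d)`!%:R)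
      * limit_moment m j.
Proof.
elim: d => [|d IHd].
  rewrite big_nat1 !limit_moment1 /= addn0 fact0 divr1 mul1r mulr1.
  by rewrite !divff ?mulr1 ?fact_neq0// pnatr_eq0.
rewrite limit_moment_rec IHd [in RHS]big_nat_recr//= [RHS]mulrDr addnS.
have m1 : (m + d).+1%:R != 0 :> R by rewrite pnatr_eq0.
have m2 : (m + d).+2%:R != 0 :> R by rewrite pnatr_eq0.
have d2 : d.+2%:R != 0 :> R by rewrite pnatr_eq0.
congr (_ + _).
  rewrite !big_distrr; apply: eq_bigr => j _ /=.
  rewrite (natr_factS d) (natr_factS (m + d)).
  move: (fact_neq0 j) (fact_neq0 (m + d)) m1 m2.
  move: (j`!%:R) ((m + d)`!%:R) ((m + d).+1%:R) ((m + d).+2%:R).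
  move: m.+1%:R d.+1%:R (_`!%:R) d`!%:R (limit_moment _ _).
  move=> a b e f S g h i j' g0 h0 i0 j0; field.
  by rewrite g0 h0 i0 j0.
rewrite (natr_factS d.+1).
move: (fact_neq0 d.+1) (fact_neq0 (m + d).+1) d2 m2.
move: (d.+1`!%:R) ((m + d).+1`!%:R) (d.+2%:R) ((m + d).+2%:R) m.+1%:R (limit_moment _ _).
move=> a b e f S g a0 b0 e0 f0; field.
by rewrite a0 b0 e0 f0.
Qed.
End Identities.

(** * Convergence of the moments of the fullest urn *)

Lemma cvg_polya_mean_max (R : realType) (n m : nat) :
  polya_mean r (fun c : config n.+1 =>
      ((\max_(i < n.+1) c i)%N%:R / (r + n.+1)%:R) ^+ m)
    @[r --> \oo] --> limit_moment R m n.+1.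
Proof.
under eq_cvg => r.
  rewrite (polya_mean_max n r (fun x => (x%:R / (r + n.+1)%:R) ^+ m)) big_add1 /=.
  over.
rewrite /limit_moment /alt_harmonic mulr_sumr big_add1 /=.
apply: cvg_big => [|k _]; first exact: add_continuous.
by rewrite mulrCA; apply: cvgM; [exact: cvg_cst|exact: cvg_polya_mean_up_div].
Qed.

Lemma fullest_urn_moment_cvg (R : realType) (disp : measure_display)
    (T : measurableType disp) (P : probability T R) (d : nat)
    (X : nat -> T -> config d) (m : nat) : (0 < d)%N -> polya_urn_process P X ->
  ('E_P[fun w => (((fullest_urn X n w)%:R / n%:R) ^+ m)%R])%E
    @[n --> \oo] --> (limit_moment R m d)%:E.
Proof.
case: d X => // n X _ hX; rewrite -(cvg_shiftn n.+1) /=.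
under eq_cvg => r.
  rewrite /fullest_urn addnK.
  rewrite (expectation_polya_mean hX (F := fun c =>
     ((\max_(i < n.+1) c i)%N%:R / (r + n.+1)%:R) ^+ m)); last first.
    by move=> c; rewrite exprn_ge0// divr_ge0.
  over.
apply: cvg_EFin; first by near=> r.
exact: cvg_polya_mean_max.
Unshelve. all: by end_near. Qed.

Theorem proposition2p1 (R : realType)
    (disp : nat -> measure_display)
    (T : forall d : nat, measurableType (disp d))
    (P : forall d : nat, probability (T d) R)
    (X : forall d : nat, nat -> T d -> config d)
    (hX : forall d : nat, (1 <= d)%N -> polya_urn_process (P d) (X d)) :
  exists M : nat -> nat -> R,
    (forall m d : nat, (1 <= d)%N ->
      ('E_(P d)[fun w => (((fullest_urn (X d) n w)%:R / n%:R) ^+ m)%R])%E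
        @[n --> \oo] --> (M m d)%:E) /\
    (forall m d : nat, (1 <= m)%N -> (2 <= d)%N ->
      [/\ M m d =
            \sum_(0 <= k < m.+1)
              (d - 1)%N%:R / d%:R ^+ k
              * (m`!%:R / (m - k)%N`!%:R)
              * ((m + d - k - 2)%N`!%:R / (m + d - 1)%N`!%:R)
              * M (m - k)%N (d - 1)%N,
          M m d =
            (d - 1)%N%:R / (m + d - 1)%N%:R * M m (d - 1)%N
            + m%:R / (d%:R * (m + d - 1)%N%:R) * M (m - 1)%N d
        & M m d =
            m%:R / (m + d - 1)%N%:R
            * \sum_(1 <= j < d.+1)
                (d - 1)%N`!%:R / j`!%:R
                * ((m + j - 2)%N`!%:R / (m + d - 2)%N`!%:R)
                * M (m - 1)%N j]).
Proof.
exists (limit_moment R); split=> [m d d0|[//|m] [//|[//|d]] _ _].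
  exact: (@fullest_urn_moment_cvg R _ _ (P d) d (X d) m d0 (hX d d0)).
have -> : (d.+2 - 1 = d.+1)%N by rewrite subn1.
have -> : (m.+1 + d.+2 - 1 = (m.+1 + d).+1)%N by rewrite !addnS subn1.
split.
- rewrite limit_moment_sum_order; apply: eq_big_nat => k _.
  by rewrite subnAC !addnS subSS subSS subn0.
- by rewrite limit_moment_rec addSn subn1.
- rewrite limit_moment_sum_urns addnS subn1; congr (_ * _).
  apply: eq_big_nat => -[//|j] _.
  by rewrite !addnS !addSn !subSS !subn0.
Qed.
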